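(* Let $k\ge 2$ be an integer and let $0<\mu<\frac{1}{2(k+1)}$. For every sufficiently large $n$ divisible by $k+1$, there exists an $\left(n,\frac{k}{k+1}+\frac{\mu}{2},\mu\right)$-incompatibility system $(G,\mathcal{F})$ that contains no compatible $k$-th power of a Hamilton cycle.
   Context: All graphs are finite and simple. An incompatibility system $\mathcal{F}$ over a graph $G=(V,E)$ is a family $\mathcal{F}=\{F_v\}_{v\in V}$ such that for every $v\in V$, $F_v$ is a family of unordered pairs $\{e,e'\}$ of distinct edges of $G$ with $e\cap e'=\{v\}$. Two edges $e,e'$ are incompatible (at $v$) if $\{e,e'\}\in F_v$ for some vertex $v$; otherwise they are compatible. A (not necessarily induced) subgraph $H\subseteq G$ is compatible if every pair of adjacent edges of $H$ is compatible. For $\Delta>0$, $\mathcal{F}$ is $\Delta$-bounded if for every vertex $v$ and every edge $e$ incident with $v$, there are at most $\Delta$ other edges incident with $v$ that are incompatible with $e$ at $v$. Given $\mu,\delta>0$ and $n\in\mathbb{N}$, an $(n,\delta,\mu)$-incompatibility system $(G,\mathcal{F})$ consists of an $n$-vertex graph $G$ with minimum degree $\delta(G)\ge\delta n$ and a $\mu n$-bounded incompatibility system $\mathcal{F}$ over $G$. The $k$-th power of a Hamilton cycle is the graph on the same vertex set whose edges join all pairs of distinct vertices at distance at most $k$ in the Hamilton cycle (where the cycle is a cyclic ordering of all $n$ vertices, and all these edges are required to be edges of $G$). *)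

(* Defs.v *)
From HB Require Import structures.
From mathcomp Require Import all_boot all_order all_algebra.
From mathcomp Require Import reals.

Set Implicit Arguments.
Unset Strict Implicit.
Unset Printing Implicit Defensive.

Import Order.TTheory GRing.Theory Num.Theory.

Local Open Scope ring_scope.

Record sgraph := SGraph {
  vertex :> finType;
  adj : rel vertex;
  adj_sym : symmetric adj;
  adj_irr : irreflexive adj
}.

Definition edges (G : sgraph) : {set {set G}} :=
  [set e | [exists x, exists y, adj x y && (e == [set x; y])]].

Definition degree (G : sgraph) (v : G) : nat := #|[set w | adj v w]|.

(* A family F assigns to each vertex a set of two-element sets of edges, each
   edge being itself a two-element set of vertices. *)
Definition incompatibility_system (G : sgraph)
    (F : G -> {set {set {set G}}}) : Prop :=
  forall (v : G) (p : {set {set G}}), p \in F v ->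
    exists e e' : {set G},
      [/\ e \in edges G, e' \in edges G, e != e', e :&: e' = [set v]
        & p = [set e; e']].

Definition incompatible_at (G : sgraph) (F : G -> {set {set {set G}}})
    (v : G) (e e' : {set G}) : bool :=
  [set e; e'] \in F v.

Definition incompatible (G : sgraph) (F : G -> {set {set {set G}}})
    (e e' : {set G}) : bool :=
  [exists v, incompatible_at F v e e'].

Definition bounded_system (R : realType) (D : R) (G : sgraph)
    (F : G -> {set {set {set G}}}) : Prop :=
  forall (v : G) (e : {set G}), e \in edges G -> v \in e ->
    #|[set e' in edges G | [&& e' != e, v \in e' & incompatible_at F v e e']]|%:R
      <= D.

Definition nincompatibility_system (R : realType) (n : nat) (delta mu : R)
    (G : sgraph) (F : G -> {set {set {set G}}}) : Prop :=
  [/\ #|G| = n,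
      forall v : G, delta * n%:R <= (degree v)%:R,
      incompatibility_system F
    & bounded_system (mu * n%:R) F].

(* Compatibility of a subgraph depends only on its edge set H; two edges are
   adjacent when they are distinct and share a vertex. *)
Definition compatible_subgraph (G : sgraph) (F : G -> {set {set {set G}}})
    (H : {set {set G}}) : Prop :=
  H \subset edges G /\
  {in H &, forall e e' : {set G},
     e != e' -> e :&: e' != set0 -> ~~ incompatible F e e'}.

Definition cyclic_ordering (T : finType) (s : seq T) : Prop :=
  uniq s /\ forall x : T, x \in s.

(* Distance between positions i, j < n on a cycle of length n: the smaller of
   j - i and i - j modulo n. *)
Definition cyc_dist (n i j : nat) : nat :=
  minn ((j + (n - i)) %% n) ((i + (n - j)) %% n).

Definition cycle_power_edges (T : finType) (k : nat) (s : seq T) :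
    {set {set T}} :=
  [set e | [exists x, exists y,
     [&& x != y, (cyc_dist (size s) (index x s) (index y s) <= k)%N
       & e == [set x; y]]]].

Definition has_compatible_hamilton_power (G : sgraph)
    (F : G -> {set {set {set G}}}) (k : nat) : Prop :=
  exists s : seq G,
    cyclic_ordering s /\ compatible_subgraph F (cycle_power_edges k s).

(* Main.v *)
(* Write n = (k + 1) m. Let A be a set of m + 1 vertices carrying a regular
   triangle-free graph whose degree lies between mu n / 2 + 1 and mu n, and join
   every vertex outside A to all other vertices. At each w outside A declare wu
   and wv incompatible whenever uv is an edge inside A. For k >= 2 every edge of
   the k-th power of a Hamilton cycle lies in a triangle of that power, and an
   edge inside A lies in no compatible triangle; so A is independent in a
   compatible k-th power, whose independent sets have at most m vertices. *)

Require Import Defs.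
From HB Require Import structures.
From mathcomp Require Import all_boot all_order all_algebra.
From mathcomp Require Import reals.
From mathcomp Require Import zify ring lra.

Set Implicit Arguments.
Unset Strict Implicit.
Unset Printing Implicit Defensive.

Import Order.TTheory GRing.Theory Num.Theory.

Local Open Scope ring_scope.

(** * Distances on a cycle *)

Lemma cyc_distC n i j : cyc_dist n i j = cyc_dist n j i.
Proof. by rewrite /cyc_dist minnC. Qed.

(** Eliminates the modulus so that [lia] applies. The case [i == j] is separate because
    [i + (n - j)] is then [n], which reduces to 0. *)
Lemma cyc_distE n i j : (i < n)%N -> (j < n)%N -> (i <= j)%N ->
  cyc_dist n i j = minn (j - i) (if i == j then 0 else i + (n - j))%N.
Proof.
move=> lt_in lt_jn le_ij; rewrite /cyc_dist; congr minn.
  by rewrite addnBA 1?ltnW // addnC -addnBA // modnDl modn_small; lia.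
case: eqP => [->|ne_ij]; first by rewrite subnKC ?modnn // ltnW.
by rewrite modn_small; lia.
Qed.

Lemma cyc_dist_triangle n k i j : (1 < k)%N -> (2 < n)%N ->
    (i < j)%N -> (j < n)%N -> (cyc_dist n i j <= k)%N ->
  exists l, [/\ (l < n)%N, l != i, l != j,
    (cyc_dist n i l <= k)%N & (cyc_dist n l j <= k)%N].
Proof.
move=> k_gt1 n_gt2 lt_ij lt_jn.
have lt_in := ltn_trans lt_ij lt_jn.
rewrite (cyc_distE lt_in lt_jn (ltnW lt_ij)) (ltn_eqF lt_ij) => le_k.
(* Addition modulo [n], by cases. Walking along the shorter arc between [i] and [j], [l] is the
   first position after its start; if the arc has length 1, [l] is the position just past its end,
   at distance at most 2 from the start, hence the need for [1 < k]. *)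
pose shift p q := (if p + q < n then p + q else p + q - n)%N.
pose l := if (j - i <= i + (n - j))%N
  then shift i (if j == i.+1 then 2 else 1)%N
  else shift j (if i + (n - j) == 1 then 2 else 1)%N.
have lt_ln : (l < n)%N by rewrite /l /shift; (repeat case: ifPn); lia.
have ne_li : l != i by rewrite /l /shift; (repeat case: ifPn); lia.
have ne_lj : l != j by rewrite /l /shift; (repeat case: ifPn); lia.
exists l; split=> //.
  by case: (leqP i l) => [le|/ltnW le]; [|rewrite cyc_distC];
     rewrite cyc_distE //; move: le; rewrite /l /shift;
     (repeat case: ifPn); lia.
by case: (leqP l j) => [le|/ltnW le]; [|rewrite cyc_distC];
   rewrite cyc_distE //; move: le; rewrite /l /shift;
   (repeat case: ifPn); lia.
Qed.

Lemma set2_eqP (T : finType) (x y a b : T) : [set x; y] = [set a; b] ->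
  x = a /\ y = b \/ x = b /\ y = a.
Proof.
move=> eq_xy.
have : x \in [set a; b] by rewrite -eq_xy set21.
have : y \in [set a; b] by rewrite -eq_xy set22.
have : a \in [set x; y] by rewrite eq_xy set21.
have : b \in [set x; y] by rewrite eq_xy set22.
rewrite !inE; do 4![case/orP=> /eqP ?]; by subst; auto.
Qed.

Lemma set2_injr (T : finType) (z : T) : injective (fun x => [set z; x]).
Proof. by move=> x y /set2_eqP[[]//|[<- ->]]. Qed.

(** * Triangles and independent sets in powers of a Hamilton cycle *)

Section CyclePower.

Variables (T : finType) (s : seq T).
Hypothesis s_cyc : cyclic_ordering s.

Let s_uniq : uniq s := s_cyc.1.
Let mem_s : forall x, x \in s := s_cyc.2.

Lemma size_cyclic_ordering : size s = #|T|.
Proof. by rewrite -(card_uniqP s_uniq); apply: eq_card => x; rewrite mem_s. Qed.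

Lemma mem_cycle_power_edges k x y : x != y ->
  (cyc_dist (size s) (index x s) (index y s) <= k)%N ->
  [set x; y] \in cycle_power_edges k s.
Proof.
move=> ne_xy le_k; rewrite inE; apply/existsP; exists x; apply/existsP.
by exists y; rewrite ne_xy le_k eqxx.
Qed.

Lemma cycle_power_edgesP k x y : [set x; y] \in cycle_power_edges k s ->
  (cyc_dist (size s) (index x s) (index y s) <= k)%N.
Proof.
rewrite inE => /existsP[a /existsP[b /and3P[_ le_k /eqP]]].
by case/set2_eqP=> -[-> ->] //; rewrite cyc_distC.
Qed.

Lemma cycle_power_triangle k x y : (1 < k)%N -> (2 < #|T|)%N -> x != y ->
    [set x; y] \in cycle_power_edges k s ->
  exists z, [/\ z != x, z != y, [set z; x] \in cycle_power_edges k s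
    & [set z; y] \in cycle_power_edges k s].
Proof.
move=> k_gt1; rewrite -size_cyclic_ordering => n_gt2.
wlog lt_xy : x y / (index x s < index y s)%N => [wl ne_xy xy_in|].
  have ne_idx : index x s != index y s.
    by apply: contraNneq ne_xy => /(index_inj x (mem_s x) (mem_s y)) ->.
  have [lt|gt|eq] := ltngtP (index x s) (index y s); first exact: wl.
    rewrite setUC in xy_in; rewrite eq_sym in ne_xy.
    by have [z [? ? ? ?]] := wl y x gt ne_xy xy_in; exists z.
  by rewrite eq eqxx in ne_idx.
move=> ne_xy /cycle_power_edgesP le_k.
have lt_yn : (index y s < size s)%N by rewrite index_mem.
have [l [lt_ln ne_lx ne_ly dx dy]] :=
  cyc_dist_triangle k_gt1 n_gt2 lt_xy lt_yn le_k.
have idx : index (nth x s l) s = l by rewrite index_uniq.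
have ne_zx : nth x s l != x by apply: contraNneq ne_lx => <-; rewrite idx.
have ne_zy : nth x s l != y by apply: contraNneq ne_ly => <-; rewrite idx.
exists (nth x s l); split=> //; apply: mem_cycle_power_edges; rewrite ?idx //.
by rewrite cyc_distC.
Qed.

(* Two vertices in the same block of k + 1 consecutive positions are joined in
   the k-th power, so an independent set has at most one vertex per block. *)
Lemma cycle_power_independent k m (A : {set T}) : #|T| = (k.+1 * m)%N ->
    {in A &, forall x y, x != y -> [set x; y] \notin cycle_power_edges k s} ->
  (#|A| <= m)%N.
Proof.
rewrite -size_cyclic_ordering => size_s indep.
have lt_block x : (index x s %/ k.+1 < m)%N.
  by rewrite ltn_divLR // mulnC -size_s index_mem.
pose block x := Ordinal (lt_block x).
rewrite -[m in leqRHS]card_ord -(card_in_imset (f := block) (D := mem A)).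
  exact: max_card.
move=> x y xA yA [eq_block]; apply/eqP; apply: contraT => ne_xy.
have /negP[] := indep x y xA yA ne_xy; apply: mem_cycle_power_edges => //.
have := divn_eq (index x s) k.+1; have := divn_eq (index y s) k.+1.
have := ltn_pmod (index x s) (ltn0Sn k).
have := ltn_pmod (index y s) (ltn0Sn k).
rewrite eq_block => ? ? ? ?.
have ? : (index x s < size s)%N by rewrite index_mem.
have ? : (index y s < size s)%N by rewrite index_mem.
by case: (leqP (index x s) (index y s)) => [le|/ltnW le]; [|rewrite cyc_distC];
   rewrite cyc_distE // geq_min; apply/orP; left; lia.
Qed.

End CyclePower.

(** * Regular triangle-free circulant graphs *)

Lemma card_ord_interval M a b : (b < M)%N ->
  #|[set x : 'I_M | (a <= x <= b)%N]| = (b.+1 - a)%N.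
Proof.
move=> lt_bM; rewrite -[RHS]muln1 -sum_nat_const_nat.
rewrite (big_nat_widen _ _ _ _ _ lt_bM).
by rewrite big_geq_mkord -sum1dep_card; apply: eq_bigl => i; rewrite andbC.
Qed.

(* The connection set is the interval [a, m + 1 - a] of Z/(m + 1); it is
   symmetric, and sum-free because it lies in the open middle third. *)
Lemma triangle_free_circulant m a : (m.+1 < 3 * a)%N -> (2 * a <= m.+1)%N ->
  exists e : rel 'I_m.+1,
    [/\ symmetric e, irreflexive e,
        forall x y z, e x y -> e y z -> ~~ e x z
      & forall x, #|[set y | e x y]| = (m.+2 - 2 * a)%N].
Proof.
move=> lt_3a le_2a.
pose S := [set x : 'I_m.+1 | (a <= x <= m.+1 - a)%N].
have S_opp x : (- x \in S) = (x \in S).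
  suff sub y : y \in S -> - y \in S.
    by apply/idP/idP => [/sub|/sub//]; rewrite opprK.
  by rewrite !inE /= => y_in; rewrite modn_small; have := ltn_ord y; lia.
exists (fun x y => y - x \in S); split=> [x y|x|x y z|x].
- by rewrite -S_opp opprB.
- by rewrite subrr inE /=; lia.
- have -> : z - x = (y - x) + (z - y) by rewrite [RHS]addrC subrKA.
  move: (y - x) (z - y) => u v; rewrite !inE /= => u_in v_in.
  have := ltn_ord u; have := ltn_ord v.
  (* Without wrap-around the sum is at least 2a > m + 1 - a; with it, the residue is at most m + 1 -
     2a < a. *)
  case: (ltnP (u + v) m.+1) => [lt|ge]; first by rewrite modn_small //; lia.
  by rewrite -(subnK ge) modnDr modn_small; lia.
rewrite -[LHS]/#|[set y | (y - x) \in S]|.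
have -> : [set y | y - x \in S] = [set u + x | u in S].
  apply/setP=> y; rewrite inE; apply/idP/imsetP => [yS|[u uS ->]].
    by exists (y - x); rewrite ?subrK.
  by rewrite addrK.
rewrite card_imset; last exact: addIr.
by rewrite card_ord_interval; lia.
Qed.

(** * The join with a complete graph and its incompatibilities *)

Lemma set2_edges (G : sgraph) (x y : G) : ([set x; y] \in edges G) = adj x y.
Proof.
rewrite inE; apply/existsP/idP => [[a /existsP[b /andP[ab /eqP]]]|xy].
  by case/set2_eqP=> -[-> ->] //; rewrite adj_sym.
by exists x; apply/existsP; exists y; rewrite xy eqxx.
Qed.

Section Join.

Variables (A B : finType) (e : rel A).
Hypotheses (e_sym : symmetric e) (e_irr : irreflexive e).

Definition join_adj (x y : A + B) : bool :=
  match x, y with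
  | inl u, inl v => e u v
  | _, _ => x != y
  end.

Lemma join_adj_sym : symmetric join_adj.
Proof. by case=> [u|u] [v|v] //=; rewrite eq_sym. Qed.

Lemma join_adj_irr : irreflexive join_adj.
Proof. by case=> u /=; rewrite ?e_irr ?eqxx. Qed.

Definition join_graph : sgraph := SGraph join_adj_sym join_adj_irr.

Definition join_system (w : join_graph) : {set {set {set join_graph}}} :=
  if w is inl _ then set0 else
  [set p | [exists u : A, exists v : A,
     e u v && (p == [set [set w; inl u]; [set w; inl v]])]].

Lemma join_systemP (b : B) p :
  reflect (exists u v : A, e u v /\
             p = [set [set (inr b : join_graph); inl u]; [set inr b; inl v]])
          (p \in join_system (inr b)).
Proof.
rewrite inE; apply: (iffP existsP) => [[u /existsP[v /andP[uv /eqP->]]]|].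
  by exists u, v.
by case=> u [v [uv ->]]; exists u; apply/existsP; exists v; rewrite uv eqxx.
Qed.

Lemma rel_neq u v : e u v -> u != v.
Proof. by apply: contraTneq => ->; rewrite e_irr. Qed.

Lemma join_system_incompatibility : incompatibility_system join_system.
Proof.
case=> [a|b] p; first by rewrite inE.
case/join_systemP=> u [v [uv ->]].
exists [set (inr b : join_graph); inl u], [set (inr b : join_graph); inl v].
split; rewrite ?set2_edges //.
  by apply: contra (rel_neq uv) => /eqP/set2_injr [->].
apply/setP=> x; rewrite !inE; case: (x =P inr b) => //= _.
by apply: contraNF (rel_neq uv) => /andP[/eqP-> /eqP[->]].
Qed.

(** At a vertex of [B], only edges to [A] conflict, and the edge to [u] conflicts just with the
    edges to the [e]-neighbours of [u]. Hence a degree bound for [e] suffices. *)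
Lemma join_system_bounded (R : realType) (D : R) : 0 <= D ->
  (forall u, #|[set v | e u v]|%:R <= D) -> bounded_system D join_system.
Proof.
move=> D_ge0 deg_le [a|b] f _ _.
  rewrite eq_card0 // => f'; rewrite !inE /incompatible_at inE.
  by rewrite !andbF.
set X := [set f' in _ | _].
have [->|[f0]] := set_0Vmem X; first by rewrite cards0.
rewrite inE => /and4P[_ _ _ /join_systemP[u0 [v0 [uv0 eq0]]]].
have [u def_f] : exists u, f = [set (inr b : join_graph); inl u].
  have := set21 f f0; rewrite eq0 !inE.
  by case/orP=> /eqP->; [exists u0 | exists v0].
apply: le_trans (deg_le u); rewrite ler_nat /X def_f.
pose spoke v := [set (inr b : join_graph); inl v].
rewrite -(card_imset [set v | e u v] (f := spoke)).
  apply/subset_leq_card/subsetP=> f'.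
  rewrite inE => /and4P[_ _ _ /join_systemP[u' [v' [uv /set2_eqP]]]].
  case=> -[/set2_injr[eq_u] ->]; apply: imset_f; rewrite inE eq_u //.
  by rewrite e_sym.
by move=> v v' /set2_injr[].
Qed.

Lemma join_degree_inl u :
  degree (inl u : join_graph) = (#|[set v | e u v]| + #|B|)%N.
Proof.
rewrite /degree -sum1dep_card big_sumType /= sum1dep_card.
by rewrite sum1_card.
Qed.

Lemma join_degree_inr b : degree (inr b : join_graph) = (#|A| + #|B|).-1.
Proof.
rewrite -card_sum -(cardC1 (inr b : A + B)) /degree cardsE.
by apply: eq_card => -[v|v]; rewrite !inE //= eq_sym.
Qed.

Lemma join_no_power k m : (1 < k)%N -> (m < #|A|)%N ->
    (#|A| + #|B| = k.+1 * m)%N -> (2 < #|A| + #|B|)%N ->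
    (forall x y z, e x y -> e y z -> ~~ e x z) ->
  ~ has_compatible_hamilton_power join_system k.
Proof.
move=> k_gt1 lt_mA card_AB n_gt2 e_tri [s [s_cyc [/subsetP sub compat]]].
have : (#|[set (inl u : join_graph) | u : A]| <= m)%N; last first.
  apply/negP; rewrite -ltnNge card_imset; first by rewrite cardT -cardE.
  by move=> u v [].
apply: (cycle_power_independent s_cyc (k := k)); first by rewrite card_sum.
move=> _ _ /imsetP[u _ ->] /imsetP[v _ ->] ne_uv; apply/negP=> uv_in.
have uv : e u v by have := sub _ uv_in; rewrite set2_edges.
(* A third vertex in [A] would close a triangle of [e]; one in [B] makes its edges to [u] and [v]
   incompatible. *)
have := cycle_power_triangle s_cyc k_gt1 _ ne_uv uv_in.
rewrite card_sum => /(_ n_gt2)[[w|b] [_ _ zu_in zv_in]].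
  have := sub _ zu_in; have := sub _ zv_in; rewrite !set2_edges /= => wv wu.
  by have := e_tri _ _ _ wu uv; rewrite wv.
have ne_zuv : [set (inr b : join_graph); inl u] != [set inr b; inl v].
  by apply: contra_neq ne_uv => /set2_injr.
have /negP[] : ~~ incompatible join_system
    [set (inr b : join_graph); inl u] [set inr b; inl v].
  by apply: compat => //; apply/set0Pn; exists (inr b); rewrite !inE eqxx.
by apply/existsP; exists (inr b); apply/join_systemP; exists u, v.
Qed.

End Join.

(** * Choice of parameters and verification of the bounds *)

Theorem mainTheorem2 (R : realType) (k : nat) (mu : R)
  (hk : (2 <= k)%N) (hmu0 : 0 < mu) (hmu1 : mu < 1 / (2 * (k%:R + 1))) :
  exists N : nat, forall n : nat, (N <= n)%N -> (k.+1 %| n)%N ->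
    exists (G : sgraph) (F : G -> {set {set {set G}}}),
      nincompatibility_system n (k%:R / (k%:R + 1) + mu / 2) mu F /\
      ~ has_compatible_hamilton_power F k.
Proof.
(* The threshold forces mu n >= 12, hence c >= 6 below. *)
exists (Num.truncn (12 / mu)).+1 => n n_large /dvdnP[m def_n].
have k1_gt0 : 0 < k%:R + 1 :> R by rewrite ltr_wpDl.
have nE : n%:R = m%:R * (k%:R + 1) :> R by rewrite def_n natrM -natr1.
have mun_ge : 12 <= mu * n%:R.
  rewrite mulrC -ler_pdivrMr //; apply/ltW/(lt_le_trans (truncnS_gt _)).
  by rewrite ler_nat.
have m_gt0 : 0 < m%:R :> R.
  by rewrite ltr0n; case: (m) nE mun_ge => // ->; lra.
have mun_lt : 2 * (mu * n%:R) < m%:R.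
  rewrite nE; move: hmu1; rewrite ltr_pdivlMr; last by lra.
  by nra.
(* The circulant has degree m + 2 - 2a, whose parity is forced by m; with
   c <= mu n / 2 < c + 1 the choice of a makes it c + 2 or c + 3. *)
pose c := Num.truncn (mu * n%:R / 2).
have /andP[c_le c_gt] : c%:R <= mu * n%:R / 2 < c.+1%:R.
  by apply: truncn_itv; lra.
have c_ge : (6 <= c)%N by rewrite truncn_ge_nat; lra.
have cm : (4 * c < m)%N by rewrite -(ltr_nat R) natrM; lra.
pose a := (m - c)./2.
have [|| e [e_sym e_irr e_tri e_deg]] := @triangle_free_circulant m a.
(* As m > 4c and c >= 6, m > 3c + 5, which yields m + 1 < 3a despite the rounding in [a]. *)
- by rewrite /a; lia.
- by rewrite /a; lia.
have le_mn : (m.+1 <= n)%N by rewrite def_n; nia.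
pose d := (m.+2 - 2 * a)%N.
have le_cd : (c.+2 <= d)%N by rewrite /d /a; lia.
have le_dc : (d <= c + 3)%N by rewrite /d /a; lia.
have cardE : (#|'I_m.+1| + #|'I_(n - m.+1)|)%N = n by rewrite !card_ord subnKC.
exists (join_graph 'I_(n - m.+1) e_sym e_irr), (@join_system _ _ _ _ _).
split; last first.
  apply: (join_no_power (m := m)) => //; rewrite ?cardE ?card_ord //.
    by rewrite def_n mulnC.
  by lia.
split.
- by rewrite card_sum.
- have mulE : (k%:R / (k%:R + 1) + mu / 2) * n%:R
      = k%:R * m%:R + mu * n%:R / 2 :> R.
    by rewrite nE; field; lra.
  have dR : (c.+2)%:R <= d%:R :> R by rewrite ler_nat.
  case=> [u|b]; rewrite mulE.
    (* Here |B| = km - 1, so d >= c + 2 makes the degree at least km + c + 1 > km + mu n / 2. *)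
    rewrite join_degree_inl e_deg card_ord natrD (natrB _ le_mn) nE.
    by move: dR c_gt; rewrite -/d nE -!natr1; lra.
  rewrite join_degree_inr cardE.
  (* The degree n - 1 = km + (m - 1) has room to spare, since m > 4c. *)
  have: (k * m + c.+1)%:R <= n.-1%:R :> R by rewrite ler_nat def_n; nia.
  by rewrite natrD natrM; lra.
- exact: join_system_incompatibility.
(* The bound follows from d <= c + 3 <= 2c <= mu n. *)
apply: join_system_bounded => [|u]; first by lra.
have dR : d%:R <= (c + 3)%:R :> R by rewrite ler_nat.
have : 6 <= c%:R :> R by rewrite (ler_nat _ 6).
by rewrite e_deg -/d; move: dR; rewrite natrD; lra.
Qed.
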